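(* Let $G=(V,E)$ be a graph with a decomposition $(A,C,B)$, and let $f:\mathbb{R}\to\mathbb{R}$. (1) If $f[-]$ preserves positivity on $\mathcal{P}_{G_{A\cup C}}$ and on $\mathcal{P}_{G_{B\cup C}}$, and is Loewner super-additive on $\mathcal{P}_{G_C}$, then $f[-]$ preserves positivity on $\mathcal{P}_G$. (2) Conversely, if $f=\psi_\alpha$ or $f=\phi_\alpha$ (for some $\alpha\in\mathbb{R}$) and $f[-]$ preserves positivity on $\mathcal{P}_G$, then $f[-]$ is Loewner super-additive on $\mathcal{P}_{G_{C'}}$ for every clique $C'\subset C$ for which there exist vertices $v_1\in A$, $v_2\in B$ that are adjacent to every $v\in C'$. In particular, when $f=\psi_\alpha$ or $f=\phi_\alpha$ and $|C|=1$, $f[-]$ preserves positivity on $\mathcal{P}_G$ if and only if $f[-]$ preserves positivity on $\mathcal{P}_{G_{A\cup C}}$ and $\mathcal{P}_{G_{B\cup C}}$ and is super-additive on $[0,\infty)$.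
   Context: All graphs are finite and simple. For $U\subset V$, $G_U$ is the subgraph of $G$ induced by $U$. A clique is a complete induced subgraph. $U\subset V$ separates $X$ from $Y$ if every path from a vertex of $X$ to a vertex of $Y$meets $U$. A decomposition of $G$ is a partition $(A,C,B)$ of $V$ such that $C$ separates $A$ from $B$ and $G_C$ is complete. For a graph $H$ on vertex set $\{1,\dots,n\}$, $\mathcal{P}_H=\mathcal{P}_H(\mathbb{R})$ is the set of real symmetric positive semidefinite $n\times n$ matrices $M$ with $m_{ij}=0$ whenever $i\ne j$ and $(i,j)$ is not an edge. For $f:\mathbb{R}\to\mathbb{R}$, $f[M]:=(f(m_{ij}))$ entrywise; $f[-]$ preserves positivity on $\mathcal{P}_H$ if $f[M]\in\mathcal{P}_H$ for all $M\in\mathcal{P}_H$. For $f$ with $f(0)=0$, $f[-]$ is Loewner super-additive on $\mathcal{P}_H$ if $f[M+N]-f[M]-f[N]\in\mathcal{P}_H$ for all $M,N\in\mathcal{P}_H$ (for $H$ a single vertex this is ordinary super-additivity on $[0,\infty)$). $\psi_\alpha(x)=\mathrm{sgn}(x)|x|^\alpha$, $\phi_\alpha(x)=|x|^\alpha$ for $x\neq0$, and $\psi_\alpha(0)=\phi_\alpha(0)=0$.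
   Formalization: In the case |C|=1, the equivalence is stated under the added assumption that some v1 in A and some v2 in B are adjacent to the vertex of C; without it the claim fails (vertices a, c, b, single edge cb, f = φ_{1/2}). *)

(* Defs.v *)
From HB Require Import structures.
From mathcomp Require Import all_boot all_order all_algebra.
From mathcomp Require Import reals exp.
Set Implicit Arguments. Unset Strict Implicit. Unset Printing Implicit Defensive.
Import Order.TTheory GRing.Theory Num.Theory.
Local Open Scope ring_scope.

Section Defs.
Variable R : realType.

Definition simple_graph (T : finType) (e : rel T) : Prop :=
  symmetric e /\ irreflexive e.

Definition vsub (T : finType) (U : {set T}) : finType := {x : T | x \in U}.
Definition induced (T : finType) (e : rel T) (U : {set T}) : rel (vsub U) :=
  fun i j => e (val i) (val j).

Definition is_clique (T : finType) (e : rel T) (U : {set T}) : Prop :=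
  forall x y, x \in U -> y \in U -> x != y -> e x y.

Definition separates (T : finType) (e : rel T) (U X Y : {set T}) : Prop :=
  forall (x : T) (p : seq T), x \in X -> last x p \in Y -> path e x p ->
    has (fun z => z \in U) (x :: p).

Definition decomposition (T : finType) (e : rel T) (A C B : {set T}) : Prop :=
  [/\ [&& [disjoint A & C], [disjoint A & B] & [disjoint C & B]],
      A :|: C :|: B = [set: T], separates e C A B & is_clique e C].

Definition psd (I : finType) (M : I -> I -> R) : Prop :=
  (forall i j, M i j = M j i) /\
  (forall x : I -> R, 0 <= \sum_i \sum_j x i * M i j * x j).

Definition PH (I : finType) (adj : rel I) (M : I -> I -> R) : Prop :=
  psd M /\ (forall i j, i != j -> ~~ adj i j -> M i j = 0).

Definition entrywise (I : finType) (f : R -> R) (M : I -> I -> R) : I -> I -> R :=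
  fun i j => f (M i j).

Definition preserves_positivity (I : finType) (adj : rel I) (f : R -> R) : Prop :=
  forall M, PH adj M -> PH adj (entrywise f M).

(* Loewner super-additivity (only defined for f with f 0 = 0) *)
Definition loewner_superadditive (I : finType) (adj : rel I) (f : R -> R) : Prop :=
  f 0 = 0 /\
  forall M N, PH adj M -> PH adj N ->
    PH adj (fun i j => f (M i j + N i j) - f (M i j) - f (N i j)).

Definition superadditive_nonneg (f : R -> R) : Prop :=
  f 0 = 0 /\ forall x y, 0 <= x -> 0 <= y -> f x + f y <= f (x + y).

Definition psi_pow (alpha : R) (x : R) : R :=
  if x == 0 then 0 else Num.sg x * (`|x| `^ alpha).
Definition phi_pow (alpha : R) (x : R) : R :=
  if x == 0 then 0 else `|x| `^ alpha.

End Defs.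

Arguments induced {T} e U.

(* Main.v *)
Require Import Defs.
From HB Require Import structures.
From mathcomp Require Import all_boot all_order all_algebra.
From mathcomp Require Import ring lra.
From mathcomp Require Import boolp classical_sets functions.
From mathcomp Require Import reals topology normedtype sequences derive realfun exp.
Import Order.TTheory GRing.Theory Num.Theory.
Import numFieldNormedType.Exports.
Set Implicit Arguments. Unset Strict Implicit. Unset Printing Implicit Defensive.
Local Open Scope ring_scope.

(** Part (1).  Gaussian elimination of the vertices of [A] writes [M = N + D],
    where [N] and [D] are positive semidefinite, [N] is supported on [A :|: C]
    and [D] on [B :|: C]; then [f[M] = f[N] + f[D] + G], where [G] is the
    super-additivity defect on [C].

    Part (2).  For vectors [u], [v] on [C'], preservation applied to
    [(1,u,0)(1,u,0)^T + (0,v,1)(0,v,1)^T] gives, by multiplicativity of [f] and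
    a Schur complement, super-additivity on the rank one matrices [u u^T],
    [v v^T].  With [k = #|C'|] this forces either [k <= alpha] or
    [f z = z ^+ n] with [n > 0]: otherwise, testing on [u = 1] and
    [v_i = sqrt d * (-2)^i] contradicts the expansion in small [d].  Natural
    powers are super-additive by the Schur product theorem.  For [k <= alpha]
    one integrates along segments, as FitzGerald and Horn do: super-additivity
    for [alpha > k] reduces to monotonicity for the derivative (exponent
    [alpha - 1]), hence to positivity for exponents above [k - 2], which follows
    by induction on [k] after subtracting a rank one matrix; [alpha = k] is a
    limit.  Differentiation exchanges [psi] and [phi]. *)

(** * Quadratic forms: pivots, Gram decompositions and Schur products *)

Definition qform {R : realType} {I : finType} (M : I -> I -> R) (x : I -> R) : R :=
  \sum_i \sum_j x i * M i j * x j.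

Section QuadraticForms.
Context {R : realType} {I : finType}.
Implicit Types (M N D : I -> I -> R) (x y a : I -> R).

Lemma eq_qform M N x : (forall i j, M i j = N i j) -> qform M x = qform N x.
Proof. by move=> MN; do 2 apply: eq_bigr => ? _; rewrite MN. Qed.

Lemma eq_qformr M x y : (forall i, x i = y i) -> qform M x = qform M y.
Proof. by move=> xy; do 2 apply: eq_bigr => ? _; rewrite !xy. Qed.

Lemma qformD M N x : qform (fun i j => M i j + N i j) x = qform M x + qform N x.
Proof.
rewrite -big_split; apply: eq_bigr => i _; rewrite -big_split.
by apply: eq_bigr => j _; rewrite mulrDr mulrDl.
Qed.

Lemma qformB M N x : qform (fun i j => M i j - N i j) x = qform M x - qform N x.
Proof.
rewrite -sumrB; apply: eq_bigr => i _; rewrite -sumrB.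
by apply: eq_bigr => j _; rewrite mulrBr mulrBl.
Qed.

Lemma qformZ c M x : qform (fun i j => c * M i j) x = c * qform M x.
Proof.
rewrite mulr_sumr; apply: eq_bigr => i _; rewrite mulr_sumr.
by apply: eq_bigr => j _; ring.
Qed.

Lemma qform_sum (J : Type) (l : seq J) (F : J -> I -> I -> R) x :
  qform (fun i j => \sum_(k <- l) F k i j) x = \sum_(k <- l) qform (F k) x.
Proof.
elim: l => [|k l IHl].
  rewrite big_nil /qform big1 // => i _; rewrite big1 // => j _.
  by rewrite big_nil mulr0 mul0r.
rewrite big_cons -IHl -qformD; apply: eq_qform => i j.
by rewrite big_cons.
Qed.

Lemma qform_rank1 a x : qform (fun i j => a i * a j) x = (\sum_i x i * a i) ^+ 2.
Proof.
rewrite expr2 mulr_suml; apply: eq_bigr => i _; rewrite mulr_sumr.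
by apply: eq_bigr => j _; ring.
Qed.

Lemma qformM a M x :
  qform (fun i j => a i * a j * M i j) x = qform M (fun i => x i * a i).
Proof. by do 2 apply: eq_bigr => ? _; ring. Qed.

Lemma qform_shift M x v t : (forall i j, M i j = M j i) ->
  qform M (fun i => x i + t *+ (i == v)) =
  qform M x + t *+ 2 * (\sum_i x i * M v i) + t ^+ 2 * M v v.
Proof.
move=> sM.
have dl (F : I -> R) : \sum_i t *+ (i == v) * F i = t * F v.
  rewrite (bigD1 v) //= eqxx big1 ?addr0 // => i /negPf->.
  by rewrite mul0r.
transitivity (qform M x + \sum_i \sum_j x i * M i j * (t *+ (j == v))
  + \sum_i t *+ (i == v) * (\sum_j M i j * x j)
  + \sum_i t *+ (i == v) * (\sum_j M i j * (t *+ (j == v)))).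
  rewrite -!big_split; apply: eq_bigr => i _ /=.
  rewrite !mulr_sumr -!big_split; apply: eq_bigr => j _ /=; ring.
rewrite !dl.
have -> : \sum_j M v j * (t *+ (j == v)) = t * M v v.
  by rewrite -dl; apply: eq_bigr => j _; rewrite mulrC.
have -> : \sum_i \sum_j x i * M i j * (t *+ (j == v)) = t * \sum_i x i * M v i.
  rewrite mulr_sumr; apply: eq_bigr => i _.
  rewrite (sM v i) -(dl (fun j => x i * M i j)).
  by apply: eq_bigr => j _; rewrite mulrC.
have -> : \sum_j M v j * x j = \sum_i x i * M v i.
  by apply: eq_bigr => j _; rewrite mulrC.
rewrite mulr2n; ring.
Qed.

Lemma qform_supp1 M x w : (forall i, i != w -> x i = 0) ->
  qform M x = x w ^+ 2 * M w w.
Proof.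
move=> x0; rewrite /qform (bigD1 w) //= (bigD1 w) //= !big1 ?addr0.
- by ring.
- by move=> i iw; rewrite big1 // => j _; rewrite x0 // !mul0r.
- by move=> i iw; rewrite (x0 i) // mulr0.
Qed.

Lemma qform0 M x : (forall i, x i = 0) -> qform M x = 0.
Proof.
by move=> x0; rewrite /qform big1 // => i _; rewrite big1 // => j _; rewrite x0 !mul0r.
Qed.

Lemma psd_rank1 a : psd (fun i j => a i * a j).
Proof. by split=> [i j|x]; [rewrite mulrC|rewrite -/(qform _ x) qform_rank1 sqr_ge0]. Qed.

Lemma psdD M N : psd M -> psd N -> psd (fun i j => M i j + N i j).
Proof.
move=> [sM pM] [sN pN]; split=> [i j|x]; first by rewrite sM sN.
by rewrite -/(qform _ x) qformD addr_ge0 ?pM ?pN.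
Qed.

Lemma psdZ c M : 0 <= c -> psd M -> psd (fun i j => c * M i j).
Proof.
move=> c0 [sM pM]; split=> [i j|x]; first by rewrite sM.
by rewrite -/(qform _ x) qformZ mulr_ge0 ?pM.
Qed.

Lemma psd_sum_rank1 (l : seq (I -> R)) : psd (fun i j => \sum_(a <- l) a i * a j).
Proof.
split=> [i j|x]; first by apply: eq_bigr => a _; rewrite mulrC.
rewrite -/(qform _ x) (qform_sum _ (fun a i j => a i * a j)).
by apply: sumr_ge0 => a _; rewrite qform_rank1 sqr_ge0.
Qed.

Lemma eq_psd M N : (forall i j, M i j = N i j) -> psd M -> psd N.
Proof.
move=> MN [sM pM]; split=> [i j|x]; first by rewrite -!MN sM.
by rewrite -/(qform N x) -(eq_qform _ MN) pM.
Qed.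

Lemma psd_diag_ge0 M v : psd M -> 0 <= M v v.
Proof.
move=> [sM pM]; have := pM (fun i => 0 + 1 *+ (i == v)).
rewrite -/(qform _ _) qform_shift // qform0 // big1 ?mulr0 ?add0r ?expr1n ?mul1r //.
by move=> i _; rewrite mul0r.
Qed.

Lemma psd_diag_eq0 M v : psd M -> M v v = 0 -> forall j, M v j = 0.
Proof.
move=> [sM pM] v0 j; apply/eqP/contraT => Mvj0.
(* As [M v v = 0], the form at [e_j + t e_v] is [M j j + 2 t M v j], affine in [t]; this [t] makes
   it [-1]. *)
have := pM (fun i => (i == j)%:R + (- (M j j + 1) / (2 * M v j)) *+ (i == v)).
rewrite -/(qform _ _) qform_shift // v0 mulr0 addr0.
rewrite (@qform_supp1 _ _ j); last by move=> i /negPf->.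
rewrite eqxx expr1n mul1r (bigD1 j) //= eqxx mul1r big1 ?addr0; last first.
  by move=> i /negPf->; rewrite mul0r.
have -> : (- (M j j + 1) / (2 * M v j)) *+ 2 * M v j = - (M j j + 1).
  by rewrite mulr2n; field.
lra.
Qed.

(* When [M v v = 0], row [v] of a positive semidefinite [M] vanishes and so
   does [pivot M v], the division by zero included. *)
Definition pivot M v i j := M v i * M v j / M v v.

Lemma pivotl M v j : psd M -> pivot M v v j = M v j.
Proof.
move=> pM; rewrite /pivot; have [v0|v0] := eqVneq (M v v) 0; last by field.
by rewrite !(psd_diag_eq0 pM v0) !mul0r.
Qed.

Lemma psd_pivot M v : psd M -> psd (pivot M v).
Proof.
move=> pM; apply: (@eq_psd (fun i j => (M v v)^-1 * (M v i * M v j))).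
  by move=> i j; rewrite mulrC.
by apply: psdZ; [rewrite invr_ge0 psd_diag_ge0|exact: psd_rank1].
Qed.

Lemma psd_sub_pivot M v : psd M -> psd (fun i j => M i j - pivot M v i j).
Proof.
move=> pM; have [sM qM] := pM; split=> [i j|x].
  by rewrite sM /pivot (mulrC (M v i)).
set s := \sum_i x i * M v i.
rewrite -/(qform _ x) qformB.
have -> : qform (pivot M v) x = (M v v)^-1 * s ^+ 2.
  by rewrite -qform_rank1 -qformZ; apply: eq_qform => i j; rewrite mulrC.
have [v0|v0] := eqVneq (M v v) 0; first by rewrite v0 invr0 mul0r subr0 qM.
(* Completing the square: [t = - s / M v v] minimises the form of [M] at [x + t e_v], and the
   minimum is the form of the difference at [x]. *)
have := qM (fun i => x i + (- s / M v v) *+ (i == v)).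
rewrite -/(qform _ _) qform_shift // -/s.
by congr (_ <= _); rewrite mulr2n; field.
Qed.

(* Symmetric Gaussian elimination along the pivots [s]. *)
Lemma psd_elim M (s : seq I) : psd M ->
  exists D (l : seq (I -> R)),
    [/\ psd D, forall i j, M i j = D i j + \sum_(a <- l) a i * a j,
        forall v j, v \in s -> D v j = 0 &
        forall i, (forall v, v \in s -> M v i = 0) -> forall j, D i j = M i j].
Proof.
move=> pM; elim: s => [|v s [D [l [pD eM D0 Di]]]].
  by exists M, [::]; split=> // i j; rewrite big_nil addr0.
have [sD _] := pD; have [sM _] := pM.
exists (fun i j => D i j - pivot D v i j).
exists ((fun i => D v i * Num.sqrt (D v v)^-1) :: l); split.
- exact: psd_sub_pivot.
- move=> i j; rewrite big_cons eM /pivot.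
  have -> : D v i * Num.sqrt (D v v)^-1 * (D v j * Num.sqrt (D v v)^-1) =
     D v i * D v j * (Num.sqrt (D v v)^-1 ^+ 2) by ring.
  by rewrite sqr_sqrtr ?invr_ge0 ?psd_diag_ge0 //; ring.
- move=> w j; rewrite inE => /predU1P[->|ws]; first by rewrite pivotl // subrr.
  by rewrite /pivot (sD v w) !(D0 w) // !mul0r subr0.
(* A row of [M] that vanishes against every pivot index is never changed, since each pivot matrix
   has a factor [D v i = 0] on it. *)
move=> i Mi0 j; have Dij k : D i k = M i k.
  by apply: Di => w ws; apply: Mi0; rewrite inE ws orbT.
by rewrite /pivot (sD v i) !Dij (sM i v) Mi0 ?mem_head // !mul0r subr0.
Qed.

Lemma psd_gram M : psd M -> exists l : seq (I -> R),
  forall i j, M i j = \sum_(a <- l) a i * a j.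
Proof.
move=> /(psd_elim (enum I))[D [l [_ eM D0 _]]]; exists l => i j.
by rewrite eM D0 ?add0r // mem_enum.
Qed.

(** Writing [D] as a sum of [a a^T] turns the form at [x] into a sum of values of [N] at the
    products [x a]. These vanish wherever [x] or the diagonal of [D] does, so [N] need only be
    nonnegative on vectors of smaller support; the induction in [spow_qform_ge0] rests on this. *)
Lemma schur_qform_ge0 D N x : psd D ->
  (forall y, (forall i, x i = 0 -> y i = 0) -> (forall i, D i i = 0 -> y i = 0) ->
    0 <= qform N y) ->
  0 <= qform (fun i j => D i j * N i j) x.
Proof.
move=> /psd_gram[l eD] N0.
have -> : qform (fun i j => D i j * N i j) x =
    \sum_(a <- l) qform N (fun i => x i * a i).
  rewrite -(eq_bigr _ (fun a _ => qformM a N x)).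
  rewrite -(qform_sum l (fun a i j => a i * a j * N i j)).
  by apply: eq_qform => i j; rewrite eD mulr_suml.
rewrite big_seq_cond; apply: sumr_ge0 => a; rewrite andbT => al.
apply: N0 => i; first by move->; rewrite mul0r.
rewrite eD => /eqP; rewrite psumr_eq0; last by move=> ? _; rewrite -expr2 sqr_ge0.
by move=> /allP/(_ a al); rewrite /= mulf_eq0 orbb => /eqP->; rewrite mulr0.
Qed.

Lemma psd_schur M N : psd M -> psd N -> psd (fun i j => M i j * N i j).
Proof.
move=> pM [sN pN]; have [sM _] := pM.
split=> [i j|x]; first by rewrite sM sN.
by apply: schur_qform_ge0 => // y _ _; apply: pN.
Qed.

End QuadraticForms.

(** * Signed powers: multiplicativity, parity and derivatives *)

Section SignedPowers.
Context {R : realType}.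
Implicit Types (b : bool) (x y : R).

(** Both functions form one family, odd for [b = true] and even for [b = false], so that
    differentiation replaces [b] by [~~ b]. *)
Definition spow b (alpha x : R) : R :=
  if b then psi_pow alpha x else phi_pow alpha x.

Lemma spow0 b alpha : spow b alpha 0 = 0.
Proof. by rewrite /spow /psi_pow /phi_pow eqxx; case: b. Qed.

Lemma spowE b alpha x :
  spow b alpha x = (if b then Num.sg x else (x != 0)%:R) * `|x| `^ alpha.
Proof.
rewrite /spow /psi_pow /phi_pow; have [->|] := eqVneq x 0.
  by case: b; rewrite ?sgr0 mul0r.
by case: b; rewrite //= mul1r.
Qed.

Lemma gt0_spow b alpha x : 0 < x -> spow b alpha x = x `^ alpha.
Proof.
by move=> x0; rewrite spowE gtr0_sg // gt_eqF // gtr0_norm // if_same mul1r.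
Qed.

Lemma spow_ge0 b alpha x : 0 <= x -> 0 <= spow b alpha x.
Proof.
rewrite le0r => /predU1P[->|x0]; first by rewrite spow0.
by rewrite gt0_spow ?powR_ge0.
Qed.

Lemma spow1 b alpha : spow b alpha 1 = 1.
Proof. by rewrite gt0_spow ?powR1. Qed.

Lemma spowM b alpha x y :
  spow b alpha (x * y) = spow b alpha x * spow b alpha y.
Proof.
rewrite !spowE normrM powRM // mulrACA; congr (_ * _).
by case: b; rewrite ?sgrM // mulf_eq0 negb_or -natrM mulnb.
Qed.

Lemma spowX b alpha x n : spow b alpha (x ^+ n) = spow b alpha x ^+ n.
Proof. by elim: n => [|n IHn]; rewrite ?spow1 // !exprS spowM IHn. Qed.

Lemma spowN b alpha x : spow b alpha (- x) = (-1) ^+ b * spow b alpha x.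
Proof.
rewrite !spowE normrN sgrN oppr_eq0.
by case: b; rewrite ?expr0 ?expr1 ?mul1r // mulN1r mulNr.
Qed.

Lemma ler_spow b alpha x y : 0 < alpha -> 0 <= x -> x <= y ->
  spow b alpha x <= spow b alpha y.
Proof.
move=> a0; rewrite le0r => /predU1P[->|x0] xy.
  by rewrite spow0 spow_ge0.
have y0 := lt_le_trans x0 xy.
rewrite !gt0_spow //; apply: ge0_ler_powR; rewrite ?nnegrE //; exact: ltW.
Qed.

Lemma is_derive_affine (f : R -> R) (a c t df : R) :
  is_derive (a + t * c) 1 f df -> is_derive t 1 (fun s => f (a + s * c)) (df * c).
Proof.
move=> Hf.
have dl : is_derive t 1 (fun s : R => a + s * c) c.
  have -> : (fun s : R => a + s * c) = cst a + c \*: (id : R -> R).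
    by apply/funext => s; rewrite [s * c]mulrC.
  by apply: is_derive_eq; rewrite add0r; exact: mulr1.
exact: is_derive1_comp.
Qed.

(** Positive [x] is the power rule, and negative [x] follows by parity. At [0] the difference
    quotient has absolute value [|h| ^ (alpha - 1)], which tends to [0] because [1 < alpha]. *)
Lemma is_derive_spow b alpha x : 1 < alpha ->
  is_derive x 1 (spow b alpha) (alpha * spow (~~ b) (alpha - 1) x).
Proof.
move=> a1; have [x0|x0|->] := ltgtP x 0.
- have dN : is_derive (0 + x * -1) 1 (spow b alpha) (alpha * (- x) `^ (alpha - 1)).
    rewrite mulrN1 add0r; apply: (@near_eq_is_derive _ R^o R^o (fun y : R => y `^ alpha)).
      near=> y; rewrite gt0_spow //; near: y.
      by apply: lt_nbhsr; rewrite oppr_gt0.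
    by apply: is_derive1_powR; rewrite oppr_gt0.
  have := is_deriveZ ((-1) ^+ b) (is_derive_affine dN).
  have -> : (-1) ^+ b \*: (fun s => spow b alpha (0 + s * -1)) = spow b alpha.
    apply/funext => s; rewrite -[LHS]/(_ * spow b alpha (0 + s * -1)).
    rewrite add0r mulrN1 spowN.
    by rewrite mulrA -expr2 sqrr_sign mul1r.
  congr is_derive.
  rewrite -[in RHS](opprK x) spowN gt0_spow ?oppr_gt0 // -[LHS]/(_ * _).
  by case: b {dN}; rewrite /= ?expr0 ?expr1; ring.
- rewrite gt0_spow //; apply: (@near_eq_is_derive _ R^o R^o (fun y : R => y `^ alpha)).
    near=> y; rewrite gt0_spow //; near: y.
    exact: lt_nbhsr.
  exact: is_derive1_powR.
rewrite spow0 mulr0.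
pose g (h : R) := h^-1 *: ((spow b alpha \o shift 0) (h *: 1) - spow b alpha 0).
have cv : (g @ dnbhs (0 : R) --> (0 : R))%classic.
  apply/cvgr0Pnorm_lt => eps eps0.
  near=> h; have h0 : h != 0 by near: h; exact: nbhs_dnbhs_neq.
  rewrite /g /= addr0 [h *: 1]mulr1 spow0 subr0 -[_ *: _]/(_ * _) normrM normfV.
  have -> : `|spow b alpha h| = `|h| `^ alpha.
    rewrite spowE normrM (ger0_norm (powR_ge0 _ _)).
    by case: (b); rewrite ?normr_sg h0 ?normr_nat mul1r.
  have a10 : 0 < alpha - 1 by rewrite subr_gt0.
  rewrite -(mulr_powRB1 (normr_ge0 h) (lt_trans ltr01 a1)) mulKf ?normr_eq0 //.
  have -> : eps = (eps `^ (alpha - 1)^-1) `^ (alpha - 1).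
    by rewrite -powRrM mulVf ?gt_eqF // powRr1 // ltW.
  apply: gt0_ltr_powR; rewrite ?nnegrE ?powR_ge0 //.
  by near: h; apply: dnbhs0_lt; exact: powR_gt0.
by apply: DeriveDef; [exact: cvgP cv|exact: cvg_lim cv].
Unshelve. all: by end_near.
Qed.

End SignedPowers.

(** * Positivity, monotonicity and super-additivity for large exponents *)

Section PowerThresholds.
Context {R : realType}.
Implicit Types (b : bool).

Lemma is_derive_sum_fin (J : finType) (h : J -> R -> R) (dh : J -> R) (t : R) :
  (forall j, is_derive t 1 (h j) (dh j)) ->
  is_derive t 1 (fun s => \sum_j h j s) (\sum_j dh j).
Proof.
move=> dhj.
have -> : (fun s => \sum_j h j s) = \sum_j h j by apply/funext => s; rewrite fct_sumE.
by elim/big_ind2 : _ => // [|f x g y]; [exact: is_derive_cst|exact: is_deriveD].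
Qed.

Lemma le_deriv_ge0 (h dh : R -> R) :
  (forall t : R, is_derive t 1 h (dh t)) ->
  (forall t, 0 <= t <= 1 -> 0 <= dh t) -> h 0 <= h 1.
Proof.
move=> hd d0.
have hd01 (t : R) : t \in `]0, 1[%R -> is_derive t 1 h (dh t) by [].
have [|t t01] := MVT_segment ler01 hd01.
  by apply: derivable_within_continuous => t _; have [] := hd t.
rewrite subr0 mulr1 => e; rewrite -subr_ge0 e; apply: d0.
by move: t01; rewrite in_itv.
Qed.

Lemma is_derive_qform (I : finType) (F : I -> I -> R -> R) (dF : I -> I -> R) x (t : R) :
  (forall i j, is_derive t 1 (F i j) (dF i j)) ->
  is_derive t 1 (fun s => qform (fun i j => F i j s) x) (qform dF x).
Proof.
move=> dFij; apply: is_derive_sum_fin => i; apply: is_derive_sum_fin => j.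
have := is_deriveZ (x i * x j) (dFij i j).
congr is_derive; first by apply/funext => s; rewrite -[LHS]/(_ * _) mulrAC.
by rewrite -[LHS]/(_ * _) mulrAC.
Qed.

Lemma is_derive_qform_spow (I : finType) b alpha (M N : I -> I -> R) x (t : R) :
  1 < alpha ->
  is_derive t 1 (fun s => qform (fun i j => spow b alpha (M i j + s * N i j)) x)
    (alpha * qform (fun i j => N i j * spow (~~ b) (alpha - 1) (M i j + t * N i j)) x).
Proof.
move=> a1; rewrite -qformZ.
apply: (is_derive_qform (F := fun i j s => spow b alpha (M i j + s * N i j))) => i j.
have := is_derive_affine (is_derive_spow b (M i j + t * N i j) a1).
by congr is_derive; ring.
Qed.

(** Along the segment [M + t N], the form has as derivative [alpha] times that of the Schur product
    of [N] with the power of opposite parity and exponent [alpha - 1]. *)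
Lemma le_qform_spow (I : finType) b alpha (M N : I -> I -> R) x : 1 < alpha ->
  (forall t, 0 <= t <= 1 ->
    0 <= qform (fun i j => N i j * spow (~~ b) (alpha - 1) (M i j + t * N i j)) x) ->
  qform (fun i j => spow b alpha (M i j)) x <=
  qform (fun i j => spow b alpha (M i j + N i j)) x.
Proof.
move=> a1 N0.
rewrite (@eq_qform _ _ _ (fun i j => spow b alpha (M i j + 0 * N i j))); last first.
  by move=> i j; rewrite mul0r addr0.
rewrite (@eq_qform _ _ (fun i j => spow b alpha (M i j + N i j))
           (fun i j => spow b alpha (M i j + 1 * N i j))); last first.
  by move=> i j; rewrite mul1r.
apply: (le_deriv_ge0 (fun t => is_derive_qform_spow b M N x t a1)) => t t01.
by rewrite mulr_ge0 ?N0 //; lra.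
Qed.

(** The induction runs on the support [S] of the test vector, with [I] fixed. Subtracting the pivot
    at [v] leaves [D] with zero row [v]; integrating from the pivot to [M] then lowers both the
    support and the exponent by one, which keeps the bound [n - 2 < beta]. *)
Lemma spow_qform_ge0 (n : nat) (I : finType) b beta (M : I -> I -> R) x
    (S : {set I}) :
  (#|S| <= n)%N -> (forall i, i \notin S -> x i = 0) -> psd M ->
  0 < beta -> n%:R - 2 < beta ->
  0 <= qform (fun i j => spow b beta (M i j)) x.
Proof.
elim: n b beta M x S => [|n IHn] b beta M x S leS xS pM b0 bn.
  rewrite qform0 // => i; apply: xS.
  by move: leS; rewrite leqn0 cards_eq0 => /eqP->; rewrite inE.
have [S0|[v vS]] := set_0Vmem S.
  by rewrite qform0 // => i; apply: xS; rewrite S0 inE.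
have cS' : (#|S :\ v| <= n)%N by move: leS; rewrite (cardsD1 v) vS.
pose Z := pivot M v; pose D i j := M i j - Z i j.
have pZ : psd Z := psd_pivot v pM.
have pD : psd D := psd_sub_pivot v pM.
have D0 j : D v j = 0 by rewrite /D /Z pivotl ?subrr.
have [sD _] := pD.
(* By multiplicativity the entrywise power of the rank one pivot is again rank one, with a
   nonnegative factor. *)
have fZ : 0 <= qform (fun i j => spow b beta (Z i j)) x.
  have -> : qform (fun i j => spow b beta (Z i j)) x =
      spow b beta (M v v)^-1 * (\sum_i x i * spow b beta (M v i)) ^+ 2.
    rewrite -qform_rank1 -qformZ; apply: eq_qform => i j.
    by rewrite /Z /pivot !spowM mulrC.
  by rewrite mulr_ge0 ?sqr_ge0 ?spow_ge0 ?invr_ge0 ?psd_diag_ge0.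
apply: le_trans fZ _.
have [n1|n2] := leqP n 1.
  pose x' i := if i == v then 0 else x i.
  rewrite -subr_ge0 -qformB.
  have -> : qform (fun i j => spow b beta (M i j) - spow b beta (Z i j)) x =
      qform (fun i j => spow b beta (M i j) - spow b beta (Z i j)) x'.
    have eqMZ i j : D i j = 0 -> spow b beta (M i j) - spow b beta (Z i j) = 0.
      by move/eqP; rewrite subr_eq0 => /eqP->; rewrite subrr.
    apply: eq_bigr => i _; apply: eq_bigr => j _; rewrite /x'.
    case: eqP => [->|_]; first by rewrite eqMZ ?D0 // !(mulr0, mul0r).
    by case: eqP => // ->; rewrite eqMZ ?(sD i) ?D0 // !(mulr0, mul0r).
  have x'0 i : i \notin S :\ v -> x' i = 0.
    by rewrite !inE negb_and negbK /x'; case: eqP => //= _; exact: xS.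
  have [S0|[w wS]] := set_0Vmem (S :\ v).
    by rewrite qform0 // => i; apply: x'0; rewrite S0 inE.
  rewrite (@qform_supp1 _ _ _ _ w); last first.
    move=> i iw; apply: x'0; apply: contraL (leq_trans cS' n1) => iS.
    have /subset_leq_card : [set i; w] \subset S :\ v.
      by rewrite finset.subUset !finset.sub1set iS.
    by rewrite cards2 iw -ltnNge.
  rewrite mulr_ge0 ?sqr_ge0 // subr_ge0 ler_spow ?psd_diag_ge0 //.
  by rewrite -subr_ge0; exact: (psd_diag_ge0 w pD).
have n2R : (2 : R) <= n%:R by rewrite (ler_nat _ 2).
have b1 : 1 < beta by move: bn; rewrite -natr1; lra.
rewrite [leRHS](@eq_qform _ _ _ (fun i j => spow b beta (Z i j + D i j))); last first.
  by move=> i j; rewrite /D addrC subrK.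
apply: le_qform_spow => // t /andP[t0 t1].
(* Since [D v v = 0], the vectors [y] vanish at [v] and are supported in [S :\ v]. *)
apply: schur_qform_ge0 => // y yx yD; apply: (IHn _ _ _ _ (S :\ v)) => //.
- move=> i; rewrite !inE negb_and negbK => /predU1P[->|/xS]; last exact: yx.
  exact/yD/D0.
- by apply: psdD => //; exact: psdZ.
- by rewrite subr_gt0.
- by move: bn; rewrite -natr1; lra.
Qed.

(** One differentiation costs one in the exponent, so the threshold is one above that for
    positivity. With at most one index, where [beta <= 1] can occur, monotonicity of the scalar
    power is enough. *)
Lemma spow_qform_mono (I : finType) b beta (M N : I -> I -> R) x :
  psd M -> psd N -> 0 < beta -> #|I|%:R - 1 < beta ->
  qform (fun i j => spow b beta (M i j)) x <=
  qform (fun i j => spow b beta (M i j + N i j)) x.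
Proof.
move=> pM pN b0 bn; have [I1|I2] := leqP #|I| 1.
  have [w _|I0] := pickP (fun _ : I => true); last first.
    by rewrite !qform0 // => i; have := I0 i.
  rewrite !(@qform_supp1 _ _ _ _ w); try by move=> i; rewrite (fintype_le1P I1 i w) eqxx.
  rewrite ler_wpM2l ?sqr_ge0 // ler_spow ?psd_diag_ge0 //.
  by rewrite lerDl psd_diag_ge0.
have n2R : (2 : R) <= #|I|%:R by rewrite (ler_nat _ 2).
have b1 : 1 < beta by lra.
apply: le_qform_spow => // t /andP[t0 t1].
apply: schur_qform_ge0 => // y _ _; apply: (@spow_qform_ge0 #|I| _ _ _ _ _ [set: I]%SET) => //.
- by rewrite cardsT.
- by move=> i; rewrite inE.
- by apply: psdD => //; exact: psdZ.
- by rewrite subr_gt0.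
- by lra.
Qed.

Lemma spow_qform_superadd_gt (I : finType) b alpha (M N : I -> I -> R) x :
  psd M -> psd N -> 1 < alpha -> #|I|%:R < alpha ->
  0 <= qform (fun i j => spow b alpha (M i j + N i j) - spow b alpha (M i j)
                         - spow b alpha (N i j)) x.
Proof.
move=> pM pN a1 an; rewrite !qformB.
(* The two ends of this path are [f[M]] and [f[M + N] - f[N]]. Its derivative is [alpha] times the
   form of the Schur product of [N] with a difference that is positive semidefinite by monotonicity
   at exponent [alpha - 1]. *)
pose h t := qform (fun i j => spow b alpha (M i j + t * N i j)) x -
  qform (fun i j => spow b alpha (0 + t * N i j)) x.
have dh t := is_deriveB (is_derive_qform_spow b M N x t a1)
  (is_derive_qform_spow b (fun _ _ => 0) N x t a1).
have := @le_deriv_ge0 h _ dh.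
have -> : h 0 = qform (fun i j => spow b alpha (M i j)) x.
  rewrite /h -qformB; apply: eq_qform => i j.
  by rewrite !mul0r !addr0 spow0 subr0.
have -> : h 1 = qform (fun i j => spow b alpha (M i j + N i j)) x -
    qform (fun i j => spow b alpha (N i j)) x.
  by rewrite /h -!qformB; apply: eq_qform => i j; rewrite !mul1r add0r.
rewrite -subr_ge0 addrAC; apply => t /andP[t0 t1].
rewrite -mulrBr mulr_ge0 //; first by lra.
rewrite -qformB.
rewrite (@eq_qform _ _ _ (fun i j => N i j *
  (spow (~~ b) (alpha - 1) (t * N i j + M i j) - spow (~~ b) (alpha - 1) (t * N i j)))).
  apply: schur_qform_ge0 => // y _ _; rewrite qformB subr_ge0.
  by apply: spow_qform_mono => //; [exact: psdZ|lra|lra].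
by move=> i j; rewrite add0r -mulrBr (addrC (t * _)).
Qed.

End PowerThresholds.

(** * The critical exponent, natural powers, and Taylor expansion of powers *)

Section CriticalExponent.
Context {R : realType}.
Implicit Types (b : bool).

Lemma derivable_spow_exponent b (z t : R) : exists d : R,
  is_derive t 1 (fun alpha : R => spow b alpha z) d.
Proof.
have [->|z0] := eqVneq z 0.
  exists (0 : R); have -> : (fun alpha : R => spow b alpha 0) = cst (0 : R).
    by apply/funext => s; rewrite spow0.
  exact: is_derive_cst.
pose c : R := if b then Num.sg z else (z != 0)%:R.
exists (c *: (expR (0 + t * ln `|z|) * ln `|z|)).
have -> : (fun alpha : R => spow b alpha z) = c \*: (fun s : R => expR (0 + s * ln `|z|)).
  apply/funext => s; rewrite spowE -[RHS]/(c * expR (0 + s * ln `|z|)) add0r.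
  by rewrite /c /powR normr_eq0 (negPf z0).
exact: (is_deriveZ c (is_derive_affine (is_derive_expR (0 + t * ln `|z|)))).
Qed.

(** For fixed matrices the form is continuous in the exponent, so a negative value at [alpha] would
    persist at slightly larger exponents, where the strict case applies. *)
Lemma spow_qform_superadd (I : finType) b alpha (M N : I -> I -> R) x :
  psd M -> psd N -> 1 <= alpha -> #|I|%:R <= alpha ->
  0 <= qform (fun i j => spow b alpha (M i j + N i j) - spow b alpha (M i j)
                         - spow b alpha (N i j)) x.
Proof.
move=> pM pN a1 an.
pose h t := qform (fun i j => spow b t (M i j + N i j) - spow b t (M i j)
                         - spow b t (N i j)) x.
rewrite -[leRHS]/(h alpha) leNgt; apply/negP => h0.
have ch : {for alpha, continuous h}.
  apply/differentiable_continuous/derivable1_diffP.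
  have dz z := cid (derivable_spow_exponent b z alpha).
  have [] // := @is_derive_qform _ _ (fun i j t => spow b t (M i j + N i j) -
    spow b t (M i j) - spow b t (N i j)) _ x alpha
    (fun i j => is_deriveB (is_deriveB (projT2 (dz (M i j + N i j)))
      (projT2 (dz (M i j)))) (projT2 (dz (N i j)))).
have hr := cvg_at_right_filter ch.
have /filter_ex[y [ya yh]] : \forall y \near at_right alpha, alpha < y /\ h y < 0.
  near=> y; split; near: y; first exact: nbhs_right_gt.
  exact: (cvgr_lt _ hr).
move: yh; rewrite ltNge => /negP; apply.
by apply: spow_qform_superadd_gt => //; [exact: le_lt_trans ya|exact: le_lt_trans ya].
Unshelve. all: by end_near.
Qed.

Lemma psd_expr (I : finType) (M : I -> I -> R) n :
  psd M -> psd (fun i j => M i j ^+ n.+1).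
Proof.
move=> pM; elim: n => [|n IHn]; first by apply: eq_psd pM => i j; rewrite expr1.
by apply: eq_psd (psd_schur pM IHn) => i j; rewrite [RHS]exprS.
Qed.

Lemma psd_expr_superadd (I : finType) (M N : I -> I -> R) n : psd M -> psd N ->
  psd (fun i j => (M i j + N i j) ^+ n.+1 - M i j ^+ n.+1 - N i j ^+ n.+1).
Proof.
move=> pM pN; elim: n => [|n IHn].
  apply: (@eq_psd _ _ (fun i j => 0 * M i j)) => [i j|]; first by rewrite !expr1; ring.
  exact: psdZ.
(* With [S_k = (M + N)^k - M^k - N^k] entrywise, [S_(k+1) = (M + N) S_k + M N^k + N M^k], a sum of
   Schur products. *)
apply: eq_psd (psdD (psd_schur (psdD pM pN) IHn)
  (psdD (psd_schur pM (psd_expr n pN)) (psd_schur pN (psd_expr n pM)))) => i j /=.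
by rewrite ![_ ^+ n.+2]exprS; ring.
Qed.

(** The generalised binomial coefficient; the recursion mirrors the derivative of
    [(1 + y) ^ alpha]. *)
Fixpoint binom_coef (alpha : R) n : R :=
  if n is n'.+1 then alpha * binom_coef (alpha - 1) n' / n'.+1%:R else 1.

(** By the mean value theorem: the derivative of the remainder of order [n + 1] is [alpha] times the
    remainder of order [n] for the exponent [alpha - 1], hence an induction over all [alpha]. *)
Lemma powR1D_taylor n alpha : exists2 K : R, 0 <= K & forall y : R, `|y| <= 2^-1 ->
  `|(1 + y) `^ alpha - \sum_(i < n) binom_coef alpha i * y ^+ i| <= K * `|y| ^+ n.
Proof.
elim: n alpha => [|n IHn] alpha.
  (* For [|y| <= 1/2] both [1 + y] and its inverse are at most [2]. *)
  exists (2 `^ `|alpha|); first exact: powR_ge0.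
  move=> y; rewrite ler_norml => /andP[y1 y2].
  have yp : 0 < 1 + y by lra.
  rewrite big_ord0 subr0 expr0 mulr1 ger0_norm ?powR_ge0 //.
  have [a0|a0] := leP 0 alpha.
    by rewrite ger0_norm //; apply: ge0_ler_powR; rewrite ?nnegrE //; lra.
  have -> : (1 + y) `^ alpha = (1 + y)^-1 `^ `|alpha|.
    by rewrite ltr0_norm // -powR_inv1 ?ltW // -powRrM mulrNN mul1r.
  have yi : 0 <= (1 + y)^-1 by rewrite invr_ge0 ltW.
  apply: ge0_ler_powR; rewrite ?nnegrE //.
  by rewrite -[leRHS]invrK lef_pV2 ?posrE ?invr_gt0 //; lra.
have [K K0 HK] := IHn (alpha - 1).
exists (`|alpha| * K) => [|y y12]; first by rewrite mulr_ge0.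
pose P := \poly_(i < n.+1) binom_coef alpha i.
pose g t := (1 + t * y) `^ alpha - P.[0 + t * y].
have ty (t : R) : t \in `[0, 1] -> `|t * y| <= `|y|.
  by rewrite in_itv /= => /andP[t0 t1]; rewrite normrM ger0_norm // ler_piMl.
have dg (t : R) : t \in `[0, 1] -> is_derive t 1 g
   (alpha * (1 + t * y) `^ (alpha - 1) * y - P^`().[0 + t * y] * y).
  move=> /ty tyy; apply: is_deriveB.
    apply: (@is_derive_affine _ (fun z => z `^ alpha)); apply: is_derive1_powR.
    by have := le_trans tyy y12; rewrite ler_norml => /andP[]; lra.
  apply: is_derive_affine; exact: is_derive_poly.
have [|t t01] := MVT_segment (@ler01 R)
    (fun (t : R) (h : t \in `]0, 1[) => dg t (subset_itv_oo_cc h)).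
  by apply: derivable_within_continuous => t /dg[].
have -> : g 0 = 0.
  rewrite /g mul0r !addr0 powR1 horner_poly big_ord_recl expr0 mulr1 big1 ?addr0 ?subrr //.
  by move=> i _; rewrite exprS mul0r mulr0.
have -> : g 1 = (1 + y) `^ alpha - \sum_(i < n.+1) binom_coef alpha i * y ^+ i.
  by rewrite /g mul1r add0r horner_poly.
rewrite !subr0 mulr1 => ->.
have -> : P^`().[0 + t * y] =
    alpha * \sum_(i < n) binom_coef (alpha - 1) i * (t * y) ^+ i.
  have -> : P^`() = \poly_(i < n) (alpha * binom_coef (alpha - 1) i).
    apply/polyP => i; rewrite coef_deriv !coef_poly ltnS.
    case: ifP => _; last by rewrite mul0rn.
    by rewrite -mulr_natr /= divfK // pnatr_eq0.
  by rewrite add0r horner_poly mulr_sumr; apply: eq_bigr => i _; rewrite mulrA.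
rewrite -mulrBl -mulrBr !normrM -!mulrA ler_wpM2l //.
rewrite exprSr mulrA ler_wpM2r //.
apply: le_trans (HK _ (le_trans (ty _ t01) y12)) _.
by rewrite ler_wpM2l // lerXn2r ?nnegrE // ty.
Qed.

End CriticalExponent.

(** * Exponents forced by super-additivity on rank one matrices *)

Section Dichotomy.
Context {R : realType}.
Implicit Types (b : bool).

Lemma powR_small (L q gamma d0 : R) : 0 <= L -> 0 < q -> 0 < gamma -> 0 < d0 ->
  exists2 d, 0 < d <= d0 & L * d `^ gamma < q.
Proof.
move=> L0 q0 g0 d00; have L1 : 0 < L + 1 by lra.
have r0 : 0 < q / (L + 1) by rewrite divr_gt0.
pose r := (q / (L + 1)) `^ gamma^-1.
have rp : 0 < r by exact: powR_gt0.
exists (Num.min d0 r); first by rewrite lt_min d00 rp ge_min lexx.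
have le_r : Num.min d0 r `^ gamma <= q / (L + 1).
  have -> : q / (L + 1) = r `^ gamma.
    by rewrite -powRrM mulVf ?gt_eqF // powRr1 // ltW.
  apply: ge0_ler_powR; rewrite ?nnegrE ?(ltW g0) ?(ltW rp) //.
    by rewrite le_min !ltW.
  by rewrite ge_min lexx orbT.
apply: le_lt_trans (ler_wpM2l L0 le_r) _.
by rewrite mulrCA gtr_pMr // ltr_pdivrMr // mul1r ltrDl.
Qed.

(** The absolute value at [-2] determines [alpha = n], and the sign there determines the parity. *)
Lemma spow_eq_exp b alpha n : (0 < n)%N -> spow b alpha (-2) = (-2) ^+ n ->
  forall z : R, spow b alpha z = z ^+ n.
Proof.
move=> n0; have s2 c : spow c alpha 2 = (2 : R) `^ alpha by rewrite gt0_spow.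
rewrite spowN s2 [(-2) ^+ n]exprNn => e.
have p2 : (0 : R) < 2 `^ alpha by exact: powR_gt0.
have e2 : (2 : R) `^ alpha = 2 ^+ n.
  have /(congr1 Num.norm) := e.
  by rewrite !normrM !normrX normrN1 !expr1n !mul1r !ger0_norm ?powR_ge0 //.
have en : alpha = n%:R.
  have l2 : ln (2 : R) != 0 by rewrite gt_eqF // ln_gt0 // ltr1n.
  have := congr1 (@ln R) e2; rewrite -powR_mulrn // !ln_powR.
  exact: (mulIf l2).
have sgn : (-1 : R) ^+ b = (-1) ^+ n.
  by apply: (mulIf (lt0r_neq0 p2)); rewrite e e2.
have pos (z : R) : 0 < z -> spow b alpha z = z ^+ n.
  by move=> z0; rewrite gt0_spow // en powR_mulrn // ltW.
move=> z; have [z0|/pos//|->] := ltgtP z 0; last first.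
  by rewrite spow0 expr0n gtn_eqF.
by rewrite -(opprK z) spowN pos ?oppr_gt0 // sgn -exprNn.
Qed.

(* Expanding [(1 + d w_i w_j)^alpha] to order [n + 1 > alpha] and testing
   against a vector orthogonal to [w, .., w^n] kills all the terms of order
   [1, .., n] in [d], so that [- d^alpha] becomes the leading one. *)
Lemma superadd_orthogonal (I : finType) b alpha n (x w : I -> R) :
  (forall u v : I -> R, 0 <= qform (fun i j => spow b alpha (u i * u j + v i * v j)
     - spow b alpha (u i * u j) - spow b alpha (v i * v j)) x) ->
  alpha < n.+1%:R ->
  (forall k, (0 < k <= n)%N -> \sum_i x i * w i ^+ k = 0) ->
  \sum_i x i * spow b alpha (w i) = 0.
Proof.
move=> sup an orth; apply/eqP/contraT => q0.
set q := \sum_i _ in q0.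
have [K K0 HK] := powR1D_taylor n.+1 alpha.
pose W := \sum_i \sum_j `|w i * w j|.
have W0 : 0 <= W by apply: sumr_ge0 => i _; apply: sumr_ge0.
have wW i j : `|w i * w j| <= W.
  rewrite /W (bigD1 i) //= (bigD1 j) //= -addrA lerDl addr_ge0 ?sumr_ge0 //.
  by move=> k _; apply: sumr_ge0.
pose L := K * \sum_i \sum_j `|x i * x j| * `|w i * w j| ^+ n.+1.
have L0 : 0 <= L.
  rewrite mulr_ge0 //; apply: sumr_ge0 => i _; apply: sumr_ge0 => j _.
  by rewrite mulr_ge0 ?exprn_ge0.
have q2 : 0 < q ^+ 2 by rewrite lt0r sqrf_eq0 q0 sqr_ge0.
have W1 : 0 < 2 * (W + 1) by lra.
(* The bound on [d] puts every [d w_i w_j] in the range of the Taylor estimate; smallness of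
   [L d ^ (n + 1 - alpha)] lets [d ^ alpha q ^ 2] exceed the remainder, which is at most
   [L d ^ (n + 1)]. *)
have [||||d /andP[d0 dW]] := @powR_small L (q ^+ 2) (n.+1%:R - alpha) (2 * (W + 1))^-1.
- by [].
- by [].
- by rewrite subr_gt0.
- by rewrite invr_gt0.
apply: contraLR => _; rewrite -leNgt.
have small i j : `|d * (w i * w j)| <= 2^-1.
  rewrite normrM gtr0_norm //.
  apply: (@le_trans _ _ ((2 * (W + 1))^-1 * (W + 1))); last by rewrite invfM mulfVK //; lra.
  by rewrite ler_pM ?(ltW d0) //; apply: le_trans (wW i j) _; lra.
have := sup (fun=> 1) (fun i => Num.sqrt d * w i).
pose P (y : R) := \sum_(k < n.+1) binom_coef alpha k * y ^+ k.
pose err i j := (1 + d * (w i * w j)) `^ alpha - P (d * (w i * w j)).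
rewrite (@eq_qform _ _ _ (fun i j => err i j +
  (\sum_(k < n.+1) (binom_coef alpha k * d ^+ k) * (w i ^+ k * w j ^+ k)) - 1 * 1 -
  d `^ alpha * (spow b alpha (w i) * spow b alpha (w j)))); last first.
  move=> i j; have -> : Num.sqrt d * w i * (Num.sqrt d * w j) = d * (w i * w j).
    by rewrite mulrACA -expr2 sqr_sqrtr // ltW.
  rewrite !mulr1 spow1 gt0_spow; last first.
    by have := small i j; rewrite ler_norml => /andP[]; lra.
  rewrite !spowM gt0_spow // /err; congr (_ - _ - _).
  rewrite (_ : \sum_(k < n.+1) _ = P (d * (w i * w j))) ?subrK //.
  by apply: eq_bigr => k _; rewrite !exprMn [RHS]mulrA.
rewrite !qformB qformD qformZ (qform_rank1 (fun i => spow b alpha (w i))) -/q.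
rewrite (qform_rank1 (fun=> 1)).
rewrite (qform_sum _ (fun (k : 'I_n.+1) i j =>
  binom_coef alpha k * d ^+ k * (w i ^+ k * w j ^+ k))).
rewrite big_ord_recl big1 ?addr0; last first.
  move=> k _; have kn : (0 < lift ord0 k <= n)%N by rewrite lift0 ltn_ord.
  by rewrite qformZ (qform_rank1 (fun i => w i ^+ _)) orth // expr2 !mulr0.
rewrite qformZ (qform_rank1 (fun i => w i ^+ _)) !expr0 !mul1r.
under [X in _ + X ^+ 2]eq_bigr do rewrite expr0.
(* The term of order [0] cancels against the form of [u u^T] with [u = 1], which leaves
   [d ^ alpha q ^ 2] bounded by the remainder. *)
rewrite addrK subr_ge0 => leq.
have le_err : qform err x <= L * d ^+ n.+1.
  rewrite /L mulrAC mulr_sumr; apply: ler_sum => i _.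
  rewrite mulr_sumr; apply: ler_sum => j _.
  have errij : `|err i j| <= K * `|d * (w i * w j)| ^+ n.+1 := HK _ (small i j).
  apply: le_trans (ler_norm _) _; rewrite [x i * _ * _]mulrAC normrM.
  apply: le_trans (ler_wpM2l (normr_ge0 _) errij) _.
  rewrite [X in K * X ^+ _]normrM exprMn (gtr0_norm d0) le_eqVlt.
  by apply/orP; left; apply/eqP; ring.
have da : 0 < d `^ alpha by exact: powR_gt0.
rewrite -(ler_pM2l da); apply: le_trans leq (le_trans le_err _).
rewrite mulrCA -powRD; last by rewrite (gt_eqF d0) implybT.
by rewrite addrC subrK powR_mulrn // ltW.
Qed.

(** The nodes are [w_i = (-2) ^ i]; the weights are the coefficients of the polynomial [Q] with
    roots [(-2) ^ 1, .., (-2) ^ n], where [n] is the integer part of [alpha]. Orthogonality says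
    that these are roots; [superadd_orthogonal] and multiplicativity make [spow b alpha (-2)] a root
    too. Being of absolute value [2 ^ alpha >= 2 ^ n], it is [(-2) ^ n]. *)
Lemma superadd_exponent (I : finType) b alpha :
  (0 < #|I|)%N -> alpha < #|I|%:R ->
  (forall (u v x : I -> R), 0 <= qform (fun i j => spow b alpha (u i * u j + v i * v j)
     - spow b alpha (u i * u j) - spow b alpha (v i * v j)) x) ->
  exists n, forall z : R, spow b alpha z = z ^+ n.+1.
Proof.
move=> /card_gt0P[i0 _] aI sup.
have a1 : 1 <= alpha.
  (* At a single index, [u = v = 1] gives [2 <= 2 ^ alpha]. *)
  have := sup (fun=> 1) (fun=> 1) (fun i => (i == i0)%:R).
  rewrite (@qform_supp1 _ _ _ _ i0); last by move=> i /negPf->.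
  rewrite eqxx !mulr1 expr1n mul1r spow1 gt0_spow ?addr_gt0 // => le2.
  rewrite leNgt; apply/negP => lt1.
  have : (2 : R) `^ alpha < 2 `^ 1.
    by rewrite /powR gt_eqF // ltr_expR ltr_pM2r // ln_gt0 // ltr1n.
  by rewrite powRr1 //; lra.
have /truncn_itv : 0 <= alpha by lra.
set n := Num.truncn alpha => /andP[na an].
have n0 : (0 < n)%N.
  by rewrite lt0n; apply: contraTneq an => ->; rewrite -leNgt.
suff : spow b alpha (-2) = (-2) ^+ n.
  by move=> e; exists n.-1 => z; rewrite prednK // (spow_eq_exp n0 e).
apply/eqP/contraT => ne.
pose Q := \prod_(z <- [seq (-2 : R) ^+ j | j <- iota 1 n]) ('X - z%:P).
pose rk (i : I) : nat := enum_rank i.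
(* The degree [n <= alpha < #|I|] lets the coefficients of [Q] be indexed by [I]. *)
have sQ : (size Q <= #|I|)%N.
  rewrite size_prod_XsubC size_map size_iota.
  by rewrite -(ltr_nat R); exact: le_lt_trans aI.
have QE z : \sum_i Q`_(rk i) * z ^+ rk i = Q.[z].
  rewrite (horner_coef_wide _ sQ) (reindex (@enum_rank I)) //.
  exact/onW_bij/enum_rank_bij.
have Q0 j : (0 < j <= n)%N -> Q.[(-2) ^+ j] = 0.
  move=> jn; apply/rootP; rewrite root_prod_XsubC.
  by apply/mapP; exists j => //; rewrite mem_iota.
have /eqP : Q.[spow b alpha (-2)] = 0.
  rewrite -QE; transitivity (\sum_i Q`_(rk i) * spow b alpha ((-2) ^+ rk i)).
    by apply: eq_bigr => i _; rewrite spowX.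
  apply: (superadd_orthogonal (fun u v => sup u v _) an) => k kn.
  by rewrite -[RHS](Q0 k kn) -QE; apply: eq_bigr => i _; rewrite exprAC.
rewrite -/(root Q _) root_prod_XsubC => /mapP[j].
rewrite mem_iota => /andP[j0]; rewrite ltnS leq_eqVlt => /predU1P[jn|jn] e.
  by rewrite e jn eqxx in ne.
have : `|(-2) ^+ j| < `|spow b alpha (-2)| :> R.
  rewrite normrX normrN ger0_norm // spowN normrM normrX normrN1 expr1n mul1r.
  rewrite gt0_spow // ger0_norm ?powR_ge0 //.
  apply: lt_le_trans (ler_powR _ na); last by rewrite ler1n.
  by rewrite powR_mulrn // ltr_eXn2l // ltr1n.
by rewrite e ltxx.
Qed.

End Dichotomy.

(** * Extension by zero and restriction of matrices *)

Section Supports.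
Context {R : realType} {T : finType}.
Implicit Types (U : {set T}).

Definition extend0 U (x : vsub U -> R) (t : T) : R :=
  if insub t is Some i then x i else 0.

Lemma extend0_val U (x : vsub U -> R) i : extend0 x (val i) = x i.
Proof. by rewrite /extend0 valK. Qed.

Lemma extend0_out U (x : vsub U -> R) t : t \notin U -> extend0 x t = 0.
Proof. by move=> tU; rewrite /extend0 insubN. Qed.

Lemma sum_vsub U (F : T -> R) :
  (forall t, t \notin U -> F t = 0) -> \sum_t F t = \sum_(i : vsub U) F (val i).
Proof.
move=> F0; rewrite (bigID (mem U)) /= [X in _ + X]big1 // addr0.
exact: big_sub.
Qed.

Lemma qform_extend0 U (M : T -> T -> R) (x : vsub U -> R) :
  qform M (extend0 x) = qform (fun i j => M (val i) (val j)) x.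
Proof.
rewrite /qform (@sum_vsub U); last first.
  by move=> t tU; rewrite big1 // => j _; rewrite (extend0_out _ tU) !mul0r.
apply: eq_bigr => i _; rewrite (@sum_vsub U); last first.
  by move=> t tU; rewrite (extend0_out _ tU) mulr0.
by apply: eq_bigr => j _; rewrite !extend0_val.
Qed.

Lemma qform_restrict U (M : T -> T -> R) (y : T -> R) :
  (forall i j, i \notin U -> M i j = 0) -> (forall i j, j \notin U -> M i j = 0) ->
  qform M y = qform (fun i j : vsub U => M (val i) (val j)) (y \o val).
Proof.
move=> Ml Mr; rewrite /qform (@sum_vsub U); last first.
  by move=> t tU; rewrite big1 // => j _; rewrite Ml // mulr0 mul0r.
apply: eq_bigr => i _; rewrite (@sum_vsub U) // => t tU.
by rewrite Mr // mulr0 mul0r.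
Qed.

Lemma psd_restrict U (M : T -> T -> R) :
  psd M -> psd (fun i j : vsub U => M (val i) (val j)).
Proof.
move=> [sM pM]; split=> [i j|x]; first exact: sM.
by rewrite -/(qform _ x) -qform_extend0; exact: pM.
Qed.

Lemma preserves_induced (e : rel T) U (f : R -> R) : f 0 = 0 ->
  preserves_positivity e f -> preserves_positivity (induced e U) f.
Proof.
move=> f0 pf M [[sM pM] M0].
pose N s t := extend0 (fun i => extend0 (M i) t) s.
have NE (i j : vsub U) : N (val i) (val j) = M i j by rewrite /N !extend0_val.
have Nl s t : s \notin U -> N s t = 0 by exact: extend0_out.
have Nr s t : t \notin U -> N s t = 0.
  by move=> tU; rewrite /N {1}/extend0; case: insub => // i; rewrite extend0_out.
have PN : PH e N.
  split; first split=> [s t|y].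
  - have [sU|sU] := boolP (s \in U); last by rewrite (Nl s) // (Nr t).
    have [tU|tU] := boolP (t \in U); last by rewrite (Nr s) // (Nl t).
    by rewrite (NE (Sub s sU) (Sub t tU)) sM -NE.
  - rewrite -/(qform _ y) (qform_restrict _ Nl Nr) (eq_qform _ NE).
    exact: pM.
  move=> s t st est; have [sU|sU] := boolP (s \in U); last by rewrite Nl.
  have [tU|tU] := boolP (t \in U); last by rewrite Nr.
  by rewrite (NE (Sub s sU) (Sub t tU)) M0 //=.
have [/(psd_restrict U) pfN _] := pf _ PN.
split; first by apply: eq_psd pfN => i j; rewrite /entrywise NE.
by move=> i j ij eij; rewrite /entrywise M0.
Qed.

End Supports.

(** * Decompositions of graphs *)

Section Decompositions.
Context {R : realType} {T : finType}.
Variables (e : rel T) (A C B : {set T}).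
Hypotheses (eG : simple_graph e) (dec : decomposition e A C B).

Lemma decomposition_nonadj i j : i \in A -> j \in B -> (i != j) && ~~ e i j.
Proof.
have [/and3P[AC AB CB] _ sep _] := dec => iA jB.
rewrite (contraTneq _ jB) => [|<-]; last by rewrite (disjointFr AB iA).
apply/negP => eij; have := sep i [:: j] iA jB; rewrite /= eij orbF => /(_ isT).
by rewrite (disjointFr AC iA) (disjointFl CB jB).
Qed.

Lemma decomposition_cover i : [|| i \in A, i \in C | i \in B].
Proof.
have [_ cov _ _] := dec.
by have := finset.in_setT i; rewrite -cov !inE -orbA.
Qed.

Lemma decomposition_preserves (f : R -> R) :
  preserves_positivity (induced e (A :|: C)) f ->
  preserves_positivity (induced e (B :|: C)) f ->
  loewner_superadditive (induced e C) f ->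
  preserves_positivity e f.
Proof.
move=> fAC fBC [f0 fC] M [pM M0].
have [sM _] := pM; have [_ _ _ clC] := dec; have [esym _] := eG.
have [D [l [pD eM DA DB]]] := psd_elim (enum A) pM.
pose N i j := \sum_(a <- l) a i * a j.
have pN : psd N := psd_sum_rank1 l.
have [sD _] := pD; have [sN _] := pN.
have DAl i j : i \in A -> D i j = 0 by move=> iA; rewrite DA ?mem_enum.
(* No vertex of [B] is adjacent to [A], so eliminating [A] leaves the rows of [B] unchanged. *)
have DBl i j : i \in B -> D i j = M i j.
  move=> iB; apply: DB => v; rewrite mem_enum => vA.
  by apply: M0; have /andP[] := decomposition_nonadj vA iB.
have NAl i j : i \in A -> N i j = M i j by move=> iA; rewrite eM DAl ?add0r.
have NBl i j : i \in B -> N i j = 0.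
  by move=> iB; apply: (addrI (D i j)); rewrite -eM addr0 DBl.
have PD : PH (induced e (B :|: C)) (fun i j => D (val i) (val j)).
  split=> [|i j ij eij]; first exact: psd_restrict.
  have vij : val i != val j by rewrite (inj_eq val_inj).
  have := valP i; rewrite inE => /orP[iB|iC]; first by rewrite DBl // M0.
  have := valP j; rewrite inE => /orP[jB|jC]; last by rewrite /induced clC in eij.
  by rewrite sD DBl // sM M0.
have PN : PH (induced e (A :|: C)) (fun i j => N (val i) (val j)).
  split=> [|i j ij eij]; first exact: psd_restrict.
  have vij : val i != val j by rewrite (inj_eq val_inj).
  have := valP i; rewrite inE => /orP[iA|iC]; first by rewrite NAl // M0.
  have := valP j; rewrite inE => /orP[jA|jC]; last by rewrite /induced clC in eij.
  by rewrite sN NAl // sM M0.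
have PDC : PH (induced e C) (fun i j => D (val i) (val j)).
  split=> [|i j ij eij]; first exact: psd_restrict.
  by rewrite /induced clC ?(valP i, valP j, inj_eq val_inj) in eij.
have PNC : PH (induced e C) (fun i j => N (val i) (val j)).
  split=> [|i j ij eij]; first exact: psd_restrict.
  by rewrite /induced clC ?(valP i, valP j, inj_eq val_inj) in eij.
split; last by move=> i j ij eij; rewrite /entrywise M0.
split=> [i j|x]; first by rewrite /entrywise sM.
pose G i j := f (D i j + N i j) - f (D i j) - f (N i j).
(* Off [C] one of [D], [N] has a zero row, and [f 0 = 0] makes the defect vanish. *)
have Gl i j : i \notin C -> G i j = 0.
  move=> iC; have := decomposition_cover i; rewrite (negPf iC) /= => /orP[iA|iB].
    by rewrite /G DAl // add0r f0 subr0 subrr.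
  by rewrite /G NBl // addr0 f0 subrr subr0.
have Gr i j : j \notin C -> G i j = 0.
  by move=> jC; rewrite -(Gl j i jC) /G (sD i) (sN i).
have fDl i j : i \notin B :|: C -> f (D i j) = 0.
  rewrite inE negb_or => /andP[iB iC]; have := decomposition_cover i.
  by rewrite (negPf iB) (negPf iC) !orbF => iA; rewrite DAl.
have fDr i j : j \notin B :|: C -> f (D i j) = 0 by rewrite sD; exact: fDl.
have fNl i j : i \notin A :|: C -> f (N i j) = 0.
  rewrite inE negb_or => /andP[iA iC]; have := decomposition_cover i.
  by rewrite (negPf iA) (negPf iC) => iB; rewrite NBl.
have fNr i j : j \notin A :|: C -> f (N i j) = 0 by rewrite sN; exact: fNl.
rewrite -/(qform _ x).
rewrite (@eq_qform _ _ _ (fun i j => G i j + (f (D i j) + f (N i j)))); last first.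
  by move=> i j; rewrite /entrywise eM -/(N i j) /G; ring.
have G0 : 0 <= qform G x.
  by rewrite (qform_restrict _ Gl Gr); have [[_ pG] _] := fC _ _ PDC PNC; exact: pG.
have fD0 : 0 <= qform (fun i j => f (D i j)) x.
  by rewrite (qform_restrict _ fDl fDr); have [[_ pfD] _] := fBC _ PD; exact: pfD.
have fN0 : 0 <= qform (fun i j => f (N i j)) x.
  by rewrite (qform_restrict _ fNl fNr); have [[_ pfN] _] := fAC _ PN; exact: pfN.
by rewrite (qformD G) (qformD (fun i j => f (D i j))) !addr_ge0.
Qed.

Lemma preserves_rank1_superadd b alpha (C' : {set T}) v1 v2 :
  preserves_positivity e (spow b alpha) ->
  C' \subset C -> is_clique e C' -> v1 \in A -> v2 \in B ->
  (forall v, v \in C' -> e v1 v /\ e v2 v) ->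
  forall u v x : vsub C' -> R,
    0 <= qform (fun i j => spow b alpha (u i * u j + v i * v j)
     - spow b alpha (u i * u j) - spow b alpha (v i * v j)) x.
Proof.
move=> pf /fintype.subsetP C'C cl v1A v2B adj u v x.
have [esym _] := eG; have [/and3P[AC AB CB] _ _ _] := dec.
have v1C : v1 \notin C' by apply: contraTN v1A => /C'C vC; rewrite (disjointFl AC vC).
have v2C : v2 \notin C' by apply: contraTN v2B => /C'C vC; rewrite (disjointFr CB vC).
have /andP[v12 e12] := decomposition_nonadj v1A v2B.
(* These are the vectors [(1, u, 0)] and [(0, v, 1)] on [v1], [C'], [v2]. *)
pose a t := extend0 u t + (t == v1)%:R.
pose c t := extend0 v t + (t == v2)%:R.
have a1 : a v1 = 1 by rewrite /a extend0_out // eqxx add0r.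
have a2 : a v2 = 0 by rewrite /a extend0_out // eq_sym (negPf v12) addr0.
have c1 : c v1 = 0 by rewrite /c extend0_out // (negPf v12) addr0.
have c2 : c v2 = 1 by rewrite /c extend0_out // eqxx add0r.
have C'v1 (i : vsub C') : (val i == v1) = false.
  by apply: contraNF v1C => /eqP<-; exact: valP.
have C'v2 (i : vsub C') : (val i == v2) = false.
  by apply: contraNF v2C => /eqP<-; exact: valP.
have aC' (i : vsub C') : a (val i) = u i by rewrite /a extend0_val C'v1 addr0.
have cC' (i : vsub C') : c (val i) = v i by rewrite /c extend0_val C'v2 addr0.
have a0 t : t \notin C' -> t != v1 -> a t = 0.
  by move=> tC t1; rewrite /a extend0_out // (negPf t1) addr0.
have c0 t : t \notin C' -> t != v2 -> c t = 0.
  by move=> tC t2; rewrite /c extend0_out // (negPf t2) addr0.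
pose M i j := a i * a j + c i * c j.
(* Adding to [C'] a vertex adjacent to all of it gives a clique, so a rank one matrix supported
   there respects the zero pattern. *)
have adjl w : (forall t, t \in C' -> e w t) -> forall i j, i != j -> ~~ e i j ->
    (i \in C') || (i == w) -> (j \in C') || (j == w) -> false.
  move=> ew i j ij eij /orP[iC|/eqP iw] /orP[jC|/eqP jw].
  - by rewrite cl in eij.
  - by rewrite jw esym ew in eij.
  - by rewrite iw ew in eij.
  - by rewrite iw jw eqxx in ij.
have rank1_0 w (g : T -> R) : (forall t, t \in C' -> e w t) ->
    (forall t, t \notin C' -> t != w -> g t = 0) ->
    forall i j, i != j -> ~~ e i j -> g i * g j = 0.
  move=> ew g0 i j ij eij.
  have [iw|] := boolP ((i \in C') || (i == w)); last first.
    by rewrite negb_or => /andP[? ?]; rewrite g0 // mul0r.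
  have [jw|] := boolP ((j \in C') || (j == w)); last first.
    by rewrite negb_or => /andP[? ?]; rewrite (g0 j) // mulr0.
  by have := adjl w ew i j ij eij iw jw.
have PM : PH e M.
  split; first by apply: psdD; exact: psd_rank1.
  move=> i j ij eij; rewrite /M (rank1_0 v1) // ?(rank1_0 v2) ?addr0 //.
    by move=> t /adj[].
  by move=> t /adj[].
pose fa t := spow b alpha (a t); pose fc t := spow b alpha (c t).
pose G i j := spow b alpha (M i j) - fa i * fa j - fc i * fc j.
have Gl i j : i \notin C' -> G i j = 0.
  move=> iC; rewrite /G /M /fa /fc -!spowM.
  have [->|i1] := eqVneq i v1; first by rewrite c1 mul0r addr0 spow0 subr0 subrr.
  by rewrite a0 // mul0r add0r spow0 subr0 subrr.
have Gr i j : j \notin C' -> G i j = 0.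
  have -> : G i j = G j i.
    by rewrite /G /M (mulrC (a i)) (mulrC (c i)) (mulrC (fa i)) (mulrC (fc i)).
  exact: Gl.
(* The Schur complement: the values at [v1] and [v2] make [y] orthogonal to [fa] and [fc], so that
   only the defect [G] on [C'] survives. *)
pose y t := extend0 x t - (\sum_i x i * fa (val i)) *+ (t == v1)
                        - (\sum_i x i * fc (val i)) *+ (t == v2).
have yC' (i : vsub C') : y (val i) = x i.
  by rewrite /y extend0_val C'v1 C'v2 !subr0.
have sum_y g : \sum_t y t * g t = \sum_i x i * g (val i)
    - (\sum_i x i * fa (val i)) * g v1 - (\sum_i x i * fc (val i)) * g v2.
  have sum_delta r w : \sum_t r *+ (t == w) * g t = r * g w :> R.
    rewrite (bigD1 w) //= eqxx big1 ?addr0 // => t /negPf->.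
    by rewrite mul0r.
  have -> : \sum_i x i * g (val i) = \sum_t extend0 x t * g t.
    rewrite (@sum_vsub _ _ C'); last by move=> t tC; rewrite (extend0_out _ tC) mul0r.
    by apply: eq_bigr => i _; rewrite extend0_val.
  rewrite -!sum_delta -!sumrB; apply: eq_bigr => t _.
  by rewrite !mulrBl.
have sa : \sum_t y t * fa t = 0.
  by rewrite sum_y /fa a1 a2 spow1 spow0 mulr0 subr0 mulr1 subrr.
have sc : \sum_t y t * fc t = 0.
  by rewrite sum_y /fc c1 c2 spow1 spow0 mulr0 subr0 mulr1 subrr.
have [[_ pfM] _] := pf _ PM.
have : 0 <= qform (entrywise (spow b alpha) M) y := pfM y.
rewrite (@eq_qform _ _ _ (fun i j => G i j + fa i * fa j + fc i * fc j)); last first.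
  by move=> i j; rewrite /entrywise /G; ring.
rewrite (qformD (fun i j => G i j + fa i * fa j)) (qformD G) !qform_rank1 sa sc.
rewrite expr0n !addr0 (qform_restrict _ Gl Gr); congr (_ <= _).
rewrite (eq_qformr _ yC'); apply: eq_qform => i j.
by rewrite /G /M /fa /fc -!spowM !aC' !cC'.
Qed.

End Decompositions.

(** * From rank one matrices to all matrices, and the theorem *)

Lemma spow_superadd_of_rank1 (R : realType) (I : finType) b alpha :
  (forall u v x : I -> R, 0 <= qform (fun i j => spow b alpha (u i * u j + v i * v j)
     - spow b alpha (u i * u j) - spow b alpha (v i * v j)) x) ->
  forall M N : I -> I -> R, psd M -> psd N ->
    psd (fun i j => spow b alpha (M i j + N i j) - spow b alpha (M i j)
                    - spow b alpha (N i j)).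
Proof.
move=> sup M N pM pN; have [sM _] := pM; have [sN _] := pN.
have [n0|I0] := posnP #|I|.
  split=> [i j|x]; first by rewrite sM sN.
  by rewrite -/(qform _ x) qform0 // => i; have := fintype0 i n0.
(* Below the threshold [#|I|] the function is a natural power, handled by Schur products; from the
   threshold on, integration along segments applies. *)
have [/(superadd_exponent I0)/(_ sup)[n fE]|aI] := ltP alpha #|I|%:R.
  by apply: eq_psd (psd_expr_superadd n pM pN) => i j; rewrite !fE.
split=> [i j|x]; first by rewrite sM sN.
rewrite -/(qform _ x); apply: spow_qform_superadd => //.
by apply: le_trans aI; rewrite ler1n.
Qed.

Theorem theorem3p2 (R : realType) (T : finType) (e : rel T)
    (A C B : {set T}) :
  simple_graph e -> decomposition e A C B ->
  (* (1) *)
  (forall f : R -> R,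
     preserves_positivity (induced e (A :|: C)) f ->
     preserves_positivity (induced e (B :|: C)) f ->
     loewner_superadditive (induced e C) f ->
     preserves_positivity e f) /\
  (* (2) *)
  (forall (f : R -> R) (alpha : R),
     (f = psi_pow alpha \/ f = phi_pow alpha) ->
     preserves_positivity e f ->
     forall C' : {set T}, C' \subset C -> is_clique e C' ->
       (exists v1 v2, [/\ v1 \in A, v2 \in B &
          forall v, v \in C' -> e v1 v /\ e v2 v]) ->
       loewner_superadditive (induced e C') f) /\
  (* in particular: |C| = 1 *)
  (forall (f : R -> R) (alpha : R),
     (f = psi_pow alpha \/ f = phi_pow alpha) ->
     #|C| = 1%N ->
     (exists v1 v2, [/\ v1 \in A, v2 \in B &
          forall v, v \in C -> e v1 v /\ e v2 v]) ->
     (preserves_positivity e f <->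
      [/\ preserves_positivity (induced e (A :|: C)) f,
          preserves_positivity (induced e (B :|: C)) f &
          superadditive_nonneg f])).
Proof.
move=> eG dec.
have spow_of (f : R -> R) alpha : f = psi_pow alpha \/ f = phi_pow alpha ->
    exists b, f = spow b alpha.
  by case=> ->; [exists true|exists false].
have part2 (f : R -> R) (alpha : R) :
    f = psi_pow alpha \/ f = phi_pow alpha ->
    preserves_positivity e f ->
    forall C' : {set T}, C' \subset C -> is_clique e C' ->
      (exists v1 v2, [/\ v1 \in A, v2 \in B &
         forall v, v \in C' -> e v1 v /\ e v2 v]) ->
      loewner_superadditive (induced e C') f.
  move=> /spow_of[b ->] pf C' C'C cl [v1 [v2 [v1A v2B adj]]].
  split=> [|M N [pM _] [pN _]]; first exact: spow0.
  split=> [|i j ij].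
    apply: spow_superadd_of_rank1 => //.
    exact: (preserves_rank1_superadd eG dec pf C'C cl v1A v2B adj).
  by rewrite /induced cl ?(valP i, valP j, inj_eq val_inj).
have [_ _ _ clC] := dec.
split; first by move=> f; exact: decomposition_preserves.
split=> // f alpha falpha C1 adj.
have /eqP/cards1P[c Cc] := C1.
have cC : c \in C by rewrite Cc finset.in_set1.
have inC t : t \in C -> t = c by rewrite Cc finset.in_set1 => /eqP.
have eqC (i j : vsub C) : i = j.
  by apply: val_inj; rewrite (inC _ (valP i)) (inC _ (valP j)).
have f0 : f 0 = 0 by have [b ->] := spow_of _ _ falpha; exact: spow0.
split=> [pf|[fAC fBC [_ fsup]]].
  split; [exact: preserves_induced..|split=> // x y x0 y0].
  have [_ supC] := part2 _ _ falpha pf C (subxx _) clC adj.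
  (* On the single vertex of [C], nonnegative scalars are the positive semidefinite matrices. *)
  have PHc (z : R) : 0 <= z -> PH (induced e C) (fun _ _ => z).
    move=> z0; split=> [|i j]; last by rewrite (eqC i j) eqxx.
    by apply: (@eq_psd _ _ (fun _ _ => z * (1 * 1))) => [i j|];
      [rewrite !mulr1|exact: psdZ z0 (psd_rank1 (fun=> 1))].
  have [pxy _] := supC _ _ (PHc x x0) (PHc y y0).
  have := psd_diag_ge0 (exist _ c cC : vsub C) pxy.
  by rewrite -addrA -opprD subr_ge0.
apply: (decomposition_preserves eG dec fAC fBC); split=> // M N [pM _] [pN _].
split=> [|i j]; last by rewrite (eqC i j) eqxx.
split=> [i j|x]; first by rewrite (eqC i j).
pose w : vsub C := exist _ c cC.
rewrite -/(qform _ x) (@qform_supp1 _ _ _ _ w); last by move=> i; rewrite (eqC i w) eqxx.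
rewrite mulr_ge0 ?sqr_ge0 // -addrA -opprD subr_ge0.
by apply: fsup; exact: psd_diag_ge0.
Qed.
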